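(* Let $\boldsymbol{u}_{\rm obs}\neq 0$ be a nonzero observation vector, let $\boldsymbol{u}_T(\boldsymbol{m})\neq 0$ be the nonzero exact terminal solution at a parameter $\boldsymbol{m}$, and let $\widetilde{\boldsymbol{u}}_T(\boldsymbol{m})\neq 0$ be a nonzero approximation satisfying $$\|\boldsymbol{u}_T(\boldsymbol{m})-\widetilde{\boldsymbol{u}}_T(\boldsymbol{m})\|\leq\epsilon_{\rm app}.$$ Assume that $$\|\boldsymbol{u}_T(\boldsymbol{m})-\boldsymbol{u}_{\rm obs}\|\leq\delta\,\|\boldsymbol{u}_{\rm obs}\|,\qquad 0<\delta<1 .$$ Then the exact normalized loss $\mathcal L^{u}_{\rm norm}(\boldsymbol{m})$ and its infinite-shot quantum approximation $\widetilde{\mathcal L}^{u}_{\rm norm}(\boldsymbol{m})$ satisfy $$\left|\mathcal L^{u}_{\rm norm}(\boldsymbol{m})-\widetilde{\mathcal L}^{u}_{\rm norm}(\boldsymbol{m})\right|\leq\frac{4\,\epsilon_{\rm app}}{(1-\delta)\,\|\boldsymbol{u}_{\rm obs}\|}.$$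
   Context: Here $n_x\geq 1$ is an integer, $\boldsymbol{u}_{\rm obs},\boldsymbol{u}_T(\boldsymbol{m})\in\mathbb{R}^{n_x}\subset\mathbb{C}^{n_x}$ and $\widetilde{\boldsymbol{u}}_T(\boldsymbol{m})\in\mathbb{C}^{n_x}$ (real or complex). $\|\cdot\|$ is the Euclidean norm, $\langle\cdot,\cdot\rangle$ the standard Hermitian inner product, and $\epsilon_{\rm app}\geq 0$. The vector $\boldsymbol{u}_T(\boldsymbol{m})$ is the vector of values at the grid points, at terminal time $T$, of the solution of an evolution PDE with parameter $\boldsymbol{m}$, and $\widetilde{\boldsymbol{u}}_T(\boldsymbol{m})$ is the approximation encoded by a quantum PDE solver; no property of these vectors other than those stated in the claim is used. The exact normalized loss is $$\mathcal L^{u}_{\rm norm}(\boldsymbol{m})=\left\|\frac{\boldsymbol{u}_T(\boldsymbol{m})}{\|\boldsymbol{u}_T(\boldsymbol{m})\|}-\frac{\boldsymbol{u}_{\rm obs}}{\|\boldsymbol{u}_{\rm obs}\|}\right\|^2=2-2\,\frac{\mathrm{Re}\langle \boldsymbol{u}_{\rm obs},\boldsymbol{u}_T(\boldsymbol{m})\rangle}{\|\boldsymbol{u}_{\rm obs}\|\,\|\boldsymbol{u}_T(\boldsymbol{m})\|},$$ and the infinite-shot normalized loss is $$\widetilde{\mathcal L}^{u}_{\rm norm}(\boldsymbol{m})=2-2\,\frac{\mathrm{Re}\langle \boldsymbol{u}_{\rm obs},\widetilde{\boldsymbol{u}}_T(\boldsymbol{m})\rangle}{\|\boldsymbol{u}_{\rm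 obs}\|\,\|\widetilde{\boldsymbol{u}}_T(\boldsymbol{m})\|}.$$ *)

(* Defs.v *)
From HB Require Import structures.
From mathcomp Require Import all_boot all_order all_algebra.
From mathcomp Require Import spectral complex.
From mathcomp Require Import reals.

Set Implicit Arguments.
Unset Strict Implicit.
Unset Printing Implicit Defensive.

Import Order.TTheory GRing.Theory Num.Theory.
Local Open Scope ring_scope.
Local Open Scope complex_scope.

(* [dotmx u v] is \sum_j u_j * (v_j)^*; it is linear in [u].  The losses only
   use the real part, which is the same for the opposite convention. *)
Definition inner (R : realType) (n : nat) (u v : 'rV[R[i]]_n) : R[i] :=
  dotmx u v.

(* The Euclidean norm.  The library norm `|u| on matrices is the sup norm. *)
Definition enorm (R : realType) (n : nat) (u : 'rV[R[i]]_n) : R :=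
  Num.sqrt (complex.Re (inner u u)).

(* The inclusion of R^n into C^n. *)
Definition embed (R : realType) (n : nat) (u : 'rV[R]_n) : 'rV[R[i]]_n :=
  map_mx (real_complex R) u.

Definition normalize (R : realType) (n : nat) (u : 'rV[R[i]]_n) :
    'rV[R[i]]_n :=
  ((enorm u)^-1)%:C *: u.

Definition exact_loss (R : realType) (n : nat) (M : Type)
    (u_obs : 'rV[R]_n) (u_T : M -> 'rV[R]_n) (m : M) : R :=
  enorm (normalize (embed (u_T m)) - normalize (embed u_obs)) ^+ 2.

Definition infinite_shot_loss (R : realType) (n : nat) (M : Type)
    (u_obs : 'rV[R]_n) (ut_T : M -> 'rV[R[i]]_n) (m : M) : R :=
  2 - 2 * (complex.Re (inner (embed u_obs) (ut_T m))
           / (enorm (embed u_obs) * enorm (ut_T m))).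

(* Main.v *)
(** Expanding the square, both losses have the form [2 - 2 <a, x / |x|>], where
    [a] is the normalized observation and [<., .>] the real part of the inner
    product.  By Cauchy-Schwarz they differ by at most
    [2 | x / |x| - y / |y| | <= 4 |x - y| / |x|], and the closeness hypothesis
    gives [|x| >= (1 - delta) |u_obs|]. *)
Require Import Defs.
From mathcomp Require Import all_boot all_order all_algebra.
From mathcomp Require Import complex reals.
From mathcomp Require Import spectral ring lra.

Set Implicit Arguments.
Unset Strict Implicit.
Unset Printing Implicit Defensive.

Import Order.TTheory GRing.Theory Num.Theory.
Local Open Scope ring_scope.

(** The Euclidean inner product of the underlying real space of dimension [2 * n]. Unlike [inner] it
    is symmetric and bilinear over [R], and it induces the same norm. *)
Definition rinner (R : realType) (n : nat) (u v : 'rV[R[i]]_n) : R :=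
  complex.Re (inner u v).

Lemma infinite_shot_lossE (R : realType) n (M : Type) (u_obs : 'rV[R]_n)
    (ut_T : M -> 'rV[R[i]]_n) m :
  infinite_shot_loss u_obs ut_T m =
  2 - 2 * (rinner (embed u_obs) (ut_T m)
           / (enorm (embed u_obs) * enorm (ut_T m))).
Proof. by []. Qed.

Lemma rinnerE (R : realType) n (u v : 'rV[R[i]]_n) :
  rinner u v = \sum_j (complex.Re (u 0 j) * complex.Re (v 0 j)
                       + complex.Im (u 0 j) * complex.Im (v 0 j)).
Proof.
rewrite /rinner /inner dotmxE mxE.
rewrite (big_morph (@complex.Re R) (id1 := 0) (op1 := +%R)) //; last first.
  by move=> [a b] [c d].
apply: eq_bigr => j _; rewrite !mxE.
by case: (u 0 j) (v 0 j) => [a b] [c d] /=; ring.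
Qed.

Lemma rinnerC (R : realType) n (u v : 'rV[R[i]]_n) : rinner u v = rinner v u.
Proof. by rewrite !rinnerE; apply: eq_bigr => j _; ring. Qed.

Lemma rinnerBl (R : realType) n (u v w : 'rV[R[i]]_n) :
  rinner (u - v) w = rinner u w - rinner v w.
Proof.
rewrite !rinnerE -sumrB; apply: eq_bigr => j _; rewrite !mxE.
by case: (u 0 j) (v 0 j) => [a b] [c d] /=; ring.
Qed.

Lemma rinner0l (R : realType) n (u : 'rV[R[i]]_n) : rinner 0 u = 0.
Proof. by have := rinnerBl 0 0 u; rewrite !subrr. Qed.

Lemma rinnerBr (R : realType) n (u v w : 'rV[R[i]]_n) :
  rinner u (v - w) = rinner u v - rinner u w.
Proof. by rewrite rinnerC rinnerBl !(rinnerC u). Qed.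

Lemma rinnerZl (R : realType) n (a : R) (u v : 'rV[R[i]]_n) :
  rinner (a%:C%C *: u) v = a * rinner u v.
Proof.
rewrite !rinnerE mulr_sumr; apply: eq_bigr => j _; rewrite !mxE.
by case: (u 0 j) => [b c] /=; ring.
Qed.

Lemma rinnerZr (R : realType) n (a : R) (u v : 'rV[R[i]]_n) :
  rinner u (a%:C%C *: v) = a * rinner u v.
Proof. by rewrite rinnerC rinnerZl rinnerC. Qed.

Lemma rinner_ge0 (R : realType) n (u : 'rV[R[i]]_n) : 0 <= rinner u u.
Proof.
by rewrite rinnerE sumr_ge0 // => j _; rewrite -!expr2 addr_ge0 ?sqr_ge0.
Qed.

Lemma enormE (R : realType) n (u : 'rV[R[i]]_n) :
  enorm u = Num.sqrt (rinner u u).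
Proof. by []. Qed.

Lemma enorm_ge0 (R : realType) n (u : 'rV[R[i]]_n) : 0 <= enorm u.
Proof. exact: sqrtr_ge0. Qed.

Lemma sqr_enorm (R : realType) n (u : 'rV[R[i]]_n) : enorm u ^+ 2 = rinner u u.
Proof. by rewrite sqr_sqrtr // rinner_ge0. Qed.

Lemma enorm_gt0 (R : realType) n (u : 'rV[R[i]]_n) : u != 0 -> 0 < enorm u.
Proof.
(* Positivity in the order of [R[i]] means equal imaginary parts and a strict inequality of real
   parts; only the latter is kept. *)
move=> /dotmx_is_dotmx; rewrite ltcE => /andP[_ u_gt0].
by rewrite sqrtr_gt0.
Qed.

(* Unifying two distinct norms is very slow when they may be unfolded. *)
Local Opaque rinner enorm.

Lemma enorm_distC (R : realType) n (u v : 'rV[R[i]]_n) :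
  enorm (u - v) = enorm (v - u).
Proof.
rewrite !enormE; apply: congr1; rewrite !rinnerBl !rinnerBr (rinnerC u v).
by move: (rinner u u) (rinner v u) (rinner v v) => a b c; ring.
Qed.

Lemma embed_neq0 (R : realType) n (u : 'rV[R]_n) : u != 0 -> embed u != 0.
Proof. by rewrite map_mx_eq0. Qed.

(** Cauchy-Schwarz without absolute value. The squared norm of [|v| u - |u| v] expands to
    [2 |u| |v| (|u| |v| - <u, v>)], which is nonnegative; cancelling [|u| |v|] requires the zero
    vectors to be treated apart. *)
Lemma rinner_le_enorm (R : realType) n (u v : 'rV[R[i]]_n) :
  rinner u v <= enorm u * enorm v.
Proof.
have [->|u0] := eqVneq u 0.
  by rewrite rinner0l mulr_ge0 ?enorm_ge0.
have [->|v0] := eqVneq v 0.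
  by rewrite rinnerC rinner0l mulr_ge0 ?enorm_ge0.
have uv_gt0 : 0 < enorm u * enorm v by rewrite mulr_gt0 ?enorm_gt0.
have := rinner_ge0 ((enorm v)%:C%C *: u - (enorm u)%:C%C *: v).
rewrite !(rinnerBl, rinnerBr) !(rinnerZl, rinnerZr) (rinnerC v u) -!sqr_enorm.
move=> h; rewrite -(ler_pM2l uv_gt0) {uv_gt0}.
by move: (enorm u) (enorm v) (rinner u v) h => a b c h; lra.
Qed.

Lemma normr_rinner_le (R : realType) n (u v : 'rV[R[i]]_n) :
  `|rinner u v| <= enorm u * enorm v.
Proof.
rewrite ler_norml rinner_le_enorm andbT lerNl.
(* The lower bound is the one-sided inequality at the opposite vector, written [0 - u] so that
   [rinnerBl] applies. *)
have Nu : enorm (0 - u) = enorm u by rewrite enorm_distC subr0.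
have := rinner_le_enorm (0 - u) v.
by rewrite Nu rinnerBl rinner0l sub0r.
Qed.

(** Triangle inequality: square both sides, expand [u = v + (u - v)], and bound the cross term by
    Cauchy-Schwarz. *)
Lemma enorm_leB (R : realType) n (u v : 'rV[R[i]]_n) :
  enorm u <= enorm v + enorm (u - v).
Proof.
rewrite -(ler_pXn2r (n := 2)) ?nnegrE ?addr_ge0 ?enorm_ge0 //.
have := rinner_le_enorm v (u - v); have := sqr_enorm (u - v).
rewrite rinnerBl !rinnerBr -!sqr_enorm (rinnerC v u).
move: (enorm u) (enorm v) (enorm (u - v)) (rinner u v) => a b c d.
by rewrite !expr2 => h1 h2; lra.
Qed.

Lemma normr_enormB_le (R : realType) n (u v : 'rV[R[i]]_n) :
  `|enorm u - enorm v| <= enorm (u - v).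
Proof.
rewrite ler_norml; have := enorm_leB u v; have := enorm_leB v u.
rewrite (enorm_distC v u); move: (enorm u) (enorm v) (enorm (u - v)) => a b c.
by lra.
Qed.

(** Scalar core of the estimate, with [p], [q] standing for inner products against a vector of norm
    [a], and [x], [y] for norms. Changing the numerator and changing the denominator each cost
    [a * d], whence the factor 2. *)
Lemma normr_divB_le (F : realFieldType) (a x y p q d : F) :
  0 < x -> 0 < y -> `|p - q| <= a * d -> `|q| <= a * y -> `|x - y| <= d ->
  `|p / x - q / y| <= 2 * a * d / x.
Proof.
move=> x0 y0 pqd qy xyd.
(* This splitting leaves [y] only inside [q / y], which is at most [a] in absolute value, so the
   final bound divides by [x] alone. *)
have -> : p / x - q / y = (p - q + q / y * (y - x)) / x.
  by field; rewrite !gt_eqF.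
rewrite normrM normfV (gtr0_norm x0) ler_pM2r ?invr_gt0 //.
apply: le_trans (ler_normD _ _) _.
have -> : 2 * a * d = a * d + a * d by ring.
rewrite lerD // normrM ler_pM //; last by rewrite distrC.
by rewrite normrM normfV (gtr0_norm y0) ler_pdivrMr.
Qed.

Lemma rinner_normalizeB_le (R : realType) n (a u v : 'rV[R[i]]_n) :
  u != 0 -> v != 0 ->
  `|rinner a u / enorm u - rinner a v / enorm v|
    <= 2 * enorm a * enorm (u - v) / enorm u.
Proof.
move=> /enorm_gt0 u0 /enorm_gt0 v0; apply: (normr_divB_le u0 v0).
- by rewrite -rinnerBr; apply: normr_rinner_le.
- exact: normr_rinner_le.
- exact: normr_enormB_le.
Qed.

Lemma sqr_enorm_normalizeB (R : realType) n (u v : 'rV[R[i]]_n) :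
  u != 0 -> v != 0 ->
  enorm (normalize u - normalize v) ^+ 2
    = 2 - 2 * (rinner v u / (enorm v * enorm u)).
Proof.
move=> /enorm_gt0 u0 /enorm_gt0 v0.
rewrite sqr_enorm /normalize !(rinnerBl, rinnerBr) !(rinnerZl, rinnerZr).
rewrite -!sqr_enorm (rinnerC u v).
move: (enorm u) (enorm v) (rinner v u) u0 v0 => a b c a0 b0.
by field; rewrite !gt_eqF.
Qed.

Theorem lemma4p1 (R : realType) (n_x : nat) (hn : (1 <= n_x)%N)
    (M : Type) (u_obs : 'rV[R]_n_x)
    (u_T : M -> 'rV[R]_n_x) (ut_T : M -> 'rV[R[i]]_n_x) (m : M)
    (eps_app delta : R) (heps : 0 <= eps_app)
    (hobs : u_obs != 0) (hT : u_T m != 0) (htT : ut_T m != 0)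
    (happ : enorm (embed (u_T m) - ut_T m) <= eps_app)
    (hdelta : 0 < delta < 1)
    (hclose : enorm (embed (u_T m) - embed u_obs)
              <= delta * enorm (embed u_obs)) :
  `|exact_loss u_obs u_T m - infinite_shot_loss u_obs ut_T m|
    <= 4 * eps_app / ((1 - delta) * enorm (embed u_obs)).
Proof.
have [o0 x0] := (embed_neq0 hobs, embed_neq0 hT).
rewrite /exact_loss infinite_shot_lossE sqr_enorm_normalizeB //.
move: (embed u_obs) (embed (u_T m)) (ut_T m) o0 x0 htT happ hclose.
move=> o x y o0 x0 y0 happ hclose.
have := rinner_normalizeB_le o x0 y0.
have := enorm_leB o x; rewrite enorm_distC.
move: (enorm_gt0 o0) (enorm_gt0 x0) (enorm_gt0 y0) happ hclose.
(* From here on only reals remain: [a], [b], [c] are the norms of the observation, the exact and the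
   approximate solution, [p] and [q] the inner products, [d] and [e] the approximation error and the
   misfit. *)
move: (enorm o) (enorm x) (enorm y) (rinner o x) (rinner o y).
move: (enorm (x - y)) (enorm (x - o)) => d e a b c p q.
move=> a0 b0 c0 d_le e_le a_le pq_le.
have -> : 2 - 2 * (p / (a * b)) - (2 - 2 * (q / (a * c)))
          = - (2 / a) * (p / b - q / c).
  by field; rewrite !gt_eqF.
case/andP: hdelta => _ delta1.
have da0 : 0 < (1 - delta) * a by rewrite mulr_gt0 ?subr_gt0.
(* Combines [a <= b + e] with [e <= delta * a]. *)
have da_le : (1 - delta) * a <= b by lra.
rewrite normrM normrN (gtr0_norm (divr_gt0 _ a0)) //.
(* The prefactor [2 / a] cancels the norm [a] coming from Cauchy-Schwarz, leaving the constant 4.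
   Then [d] is replaced by [eps_app], and [b] by its lower bound. *)
apply: (@le_trans _ _ (4 * d / b)).
  have -> : 4 * d / b = 2 / a * (2 * a * d / b) by field; rewrite !gt_eqF.
  by rewrite ler_pM2l ?divr_gt0.
apply: (@le_trans _ _ (4 * eps_app / b)).
  by rewrite ler_pM2r ?invr_gt0 // ler_pM2l.
by rewrite ler_wpM2l ?mulr_ge0 // lef_pV2 ?posrE.
Qed.
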